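(* Let $q \ge 1$ be an integer. If $G$ is a $(q+1,6)$-Moore graph, then its packing chromatic number satisfies $$\chi_\rho(G) = q^2+q+2.$$
   Context: All graphs are finite, simple and undirected; $d(u,v)$ denotes the graph distance. A packing $k$-coloring of a graph $G$ is a function $\Gamma: V(G)\to\{1,2,\dots,k\}$ such that for every $i$, any two distinct vertices of color $i$ are at distance at least $i+1$. The packing chromatic number $\chi_\rho(G)$ is the smallest integer $k$ for which $G$ has a packing $k$-coloring. A $(k,g)$-graph is a $k$-regular graph of girth $g$. For $g$ even, a $(k,g)$-Moore graph is a $(k,g)$-graph with exactly $n_0(k,g)=2\sum_{i=0}^{g/2-1}(k-1)^i$ vertices (equal to $\frac{2(k-1)^{g/2}-2}{k-2}$ when $k\ge 3$), the minimum possible. In particular a $(q+1,6)$-Moore graph has $2(q^2+q+1)$ vertices; it is the point-line incidence graph of a symmetric generalized $3$-gon (projective plane) of order $q$. *)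

(* Defs.v *)
From mathcomp Require Import all_boot.

Set Implicit Arguments.
Unset Strict Implicit.
Unset Printing Implicit Defensive.

Record sgraph := SGraph {
  vertex :> finType;
  adj : rel vertex;
  adj_sym : symmetric adj;
  adj_irr : irreflexive adj }.

Section Graph.
Variable G : sgraph.
Implicit Types (u v : G) (k g n : nat).

Definition walk_of_length u v n : bool :=
  [exists p : n.-tuple G, path (@adj G) u p && (last u p == v)].

Lemma connect_walk u v :
  connect (@adj G) u v -> exists n, walk_of_length u v n.
Proof.
case/connectP=> p e_p v_last; exists (size p); apply/existsP.
by exists (in_tuple p); rewrite /= e_p v_last eqxx.
Qed.

(* The distance is [None] (infinite) between different components. *)
Definition gdist u v : option nat :=
  if @idP (connect (@adj G) u v) is ReflectT uv
  then Some (ex_minn (connect_walk uv)) else None.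

Definition gdist_at_least u v n : bool :=
  if gdist u v is Some d then n <= d else true.

(* Colors are the elements 1, ..., k of 'I_k.+1; the value 0 is excluded. *)
Definition packing_coloring k (f : {ffun G -> 'I_k.+1}) : bool :=
  [forall u, 0 < f u] &&
  [forall u, forall v,
     (u != v) && (f u == f v) ==> gdist_at_least u v (f u).+1].

Definition packing_colorable k : bool :=
  [exists f : {ffun G -> 'I_k.+1}, packing_coloring f].

Lemma packing_colorable_exists : exists k, packing_colorable k.
Proof.
exists #|G|; apply/existsP; exists [ffun u => lift ord0 (enum_rank u)].
apply/andP; split; first by apply/forallP=> u; rewrite ffunE.
apply/forallP=> u; apply/forallP=> v; apply/implyP=> /andP[u_neq_v].
by rewrite !ffunE (inj_eq lift_inj) (inj_eq enum_rank_inj) (negPf u_neq_v).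
Qed.

Definition packing_chromatic_number : nat :=
  ex_minn packing_colorable_exists.

Definition regular k : Prop := forall u, #|[set v | adj u v]| = k.

(* [ucycle] also accepts sequences of size 0 and 2; a graph cycle has at least
   three vertices. *)
Definition graph_cycle (c : seq G) : Prop :=
  ucycle (@adj G) c /\ 3 <= size c.

Definition has_girth g : Prop :=
  (exists2 c, graph_cycle c & size c = g) /\
  (forall c, graph_cycle c -> g <= size c).

Definition kg_graph k g : Prop := regular k /\ has_girth g.

Definition moore_bound k g : nat := 2 * \sum_(i < g./2) (k - 1) ^ i.

Definition moore_graph k g : Prop :=
  [/\ ~~ odd g, kg_graph k g & #|G| = moore_bound k g].

End Graph.

(* Main.v *)
Require Import Defs.
From mathcomp Require Import all_boot zify.

Set Implicit Arguments.
Unset Strict Implicit.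
Unset Printing Implicit Defensive.

(** A (q+1,6)-Moore graph is bipartite with two parts of n = q^2+q+1 vertices,
    and two vertices in the same part always have a common neighbour.  Giving
    color 1 to one part and pairwise distinct colors to the other uses n+1
    colors.  Conversely a color >= 3 occurs at most once and color 2 at most
    twice (once in each part), while color 1 is an independent set, so occurs
    at most n times; if it occurs exactly n times it is a whole part, and then
    color 2 occurs at most once.  Hence colors 1 and 2 cover at most n+1 of the
    2n vertices. *)

(** * Distances and walks *)

Section Distance.
Variable G : sgraph.
Implicit Types u v w : G.

(** Trades the minimum hidden in [gdist] for all walk lengths. Between different components the
    distance is infinite and there is no walk, so both sides hold. *)
Lemma gdist_at_leastP u v n :
  reflect (forall m, walk_of_length u v m -> n <= m) (gdist_at_least u v n).
Proof.
rewrite /gdist_at_least /gdist.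
case: {-}_ / idP => [uv|nuv].
  case: ex_minnP => d wd dmin; apply: (iffP idP) => [le_nd m /dmin|]; last exact.
  exact: leq_trans.
apply: ReflectT => m /existsP[p /andP[pp /eqP lp]].
by case: nuv; apply/connectP; exists p.
Qed.

Lemma gdist_at_least2 u v :
  gdist_at_least u v 2 = (u != v) && ~~ adj u v.
Proof.
apply/gdist_at_leastP/andP=> [far|[neq nadj] [|[|m]] //].
- split; apply/negP=> uv.
    have/far//: walk_of_length u v 0.
    by apply/existsP; exists [tuple]; rewrite /= uv.
  have/far//: walk_of_length u v 1.
  by apply/existsP; exists [tuple v]; rewrite /= uv eqxx.
- by case/existsP=> p; rewrite tuple0 /= (negPf neq).
- case/existsP=> p; case/tupleP: p => w p; rewrite tuple0 /= andbT.
  by case/andP=> uw /eqP wv; rewrite wv (negPf nadj) in uw.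
Qed.

Lemma walk2 u w v : adj u w -> adj w v -> walk_of_length u v 2.
Proof.
by move=> uw wv; apply/existsP; exists [tuple w; v]; rewrite /= uw wv eqxx.
Qed.

Lemma walk3 u w x v :
  adj u w -> adj w x -> adj x v -> walk_of_length u v 3.
Proof.
move=> uw wx xv; apply/existsP; exists [tuple w; x; v].
by rewrite /= uw wx xv eqxx.
Qed.

End Distance.

(** * Independent sets in regular graphs *)

Definition nbhd (G : sgraph) (u : G) : {set G} := [set v | adj u v].

Definition independent (G : sgraph) (I : {set G}) : Prop :=
  {in I &, forall u v, ~~ adj u v}.

Section RegularIndependent.
Variables (G : sgraph) (d : nat).
Hypotheses (d_gt0 : 0 < d) (regG : regular G d).
Implicit Types (u v : G) (I : {set G}).

(** Double counting of the edges between [I] and its complement: all [d] edges at a vertex of [I]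
    leave [I]. *)
Lemma independent_edge_count I :
  independent I -> \sum_(v in ~: I) #|nbhd v :&: I| = #|I| * d.
Proof.
move=> indI.
under eq_bigr => v _ do rewrite -sum1_card.
rewrite (exchange_big_dep (mem I)) /=; last by move=> v u _; case/setIP.
rewrite -sum_nat_const; apply: eq_bigr => u uI.
rewrite -[RHS](regG u) sum1_card; apply: eq_card => v; rewrite !inE.
rewrite unfold_in /= !inE uI andbT adj_sym andbC.
case uv: (adj u v) => //=; apply/negP=> vI.
by case/negP: (indI u v uI vI).
Qed.

(** Each vertex of the complement receives at most [d] of the [#|I| * d] edges leaving [I]. *)
Lemma card_independent I : independent I -> #|I| <= #|~: I|.
Proof.
move=> indI; rewrite -(leq_pmul2r d_gt0) -independent_edge_count //.
rewrite -sum_nat_const; apply: leq_sum => v _.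
by rewrite -[d](regG v); apply/subset_leq_card/subsetIl.
Qed.

(** Equality in the edge count forces every vertex of the complement to have all its neighbours in
    [I]. *)
Lemma half_independentC I :
  independent I -> #|I| = #|~: I| -> independent (~: I).
Proof.
move=> indI half.
have le v : v \in ~: I -> #|nbhd v :&: I| <= d.
  by move=> _; rewrite -[d](regG v); apply/subset_leq_card/subsetIl.
have: \sum_(v in ~: I) #|nbhd v :&: I| == \sum_(v in ~: I) d.
  by rewrite independent_edge_count // half sum_nat_const.
have [_ ->] := leqif_sum (fun v vI => leqif_eq (le v vI)).
move=> /forall_inP full u v uI vI; apply/negP=> uv.
have: nbhd u :&: I == nbhd u.
  by rewrite eqEcard subsetIl (eqP (full u uI)) [leqLHS](regG u) leqnn.
move/eqP/setP/(_ v); rewrite !inE uv /=.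
by move: vI; rewrite inE => /negPf->.
Qed.

End RegularIndependent.

(** * Bipartition of a Moore graph of girth 6 *)

Section Moore.
Variables (q : nat) (G : sgraph).
Hypotheses (q_gt0 : 0 < q) (mooreG : moore_graph G (q + 1) 6).
Implicit Types (u v w x : G) (I : {set G}).

Let n := q ^ 2 + q + 1.

Lemma moore_regular : regular G (q + 1).
Proof. by case: mooreG => _ []. Qed.

Lemma moore_card : #|G| = 2 * n.
Proof.
case: mooreG => _ _ ->; rewrite /moore_bound !big_ord_recr big_ord0 /= addnK.
by rewrite /n; lia.
Qed.

Lemma moore_short_cycle (c : seq G) :
  2 < size c < 6 -> cycle (@adj G) c -> uniq c -> False.
Proof.
case: mooreG => _ [_ [_ girth]] _ /andP[gt2 lt6] cyc uc.
have /girth : graph_cycle c by split=> //; apply/andP.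
by rewrite leqNgt lt6.
Qed.

Lemma adj_neq u v : adj u v -> u != v.
Proof. by apply: contraTneq => ->; rewrite adj_irr. Qed.

Lemma no_triangle u v w : adj u v -> adj v w -> ~~ adj w u.
Proof.
move=> uv vw; apply/negP=> wu.
apply: (@moore_short_cycle [:: u; v; w]) => //=; first by rewrite uv vw wu.
by rewrite !inE negb_or adj_neq // (eq_sym u w) !adj_neq.
Qed.

Lemma common_nbr_uniq u v a b :
  u != v -> adj u a -> adj a v -> adj u b -> adj b v -> a = b.
Proof.
move=> uv ua av ub bv; apply/eqP/negPn/negP=> ab.
apply: (@moore_short_cycle [:: u; a; v; b]) => //=.
  by rewrite ua av (adj_sym v) bv adj_sym ub.
rewrite !inE !negb_or uv ab (adj_neq ua) (adj_neq av) (adj_neq ub).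
by rewrite eq_sym adj_neq.
Qed.

(* The part of the bipartition that contains [x]: since [x] has a neighbour,
   [x] itself belongs to this set. *)
Definition side x : {set G} := [set w | [exists a, adj x a && adj a w]].

Lemma sideP x w :
  reflect (exists2 a, adj x a & adj a w) (w \in side x).
Proof.
rewrite inE; apply: (iffP existsP) => [[a /andP[]]|[a xa aw]]; exists a => //.
exact/andP.
Qed.

Lemma has_nbr x : exists a, adj x a.
Proof.
have /card_gt0P[a] : 0 < #|[set v | adj x v]| by rewrite moore_regular addn1.
by rewrite inE; exists a.
Qed.

Lemma side_refl x : x \in side x.
Proof. by have [a xa] := has_nbr x; apply/sideP; exists a; rewrite // adj_sym. Qed.

(** The neighbourhoods of the q+1 neighbours of [x], with [x] removed, have q elements each and are
    disjoint since there is no 4-cycle; adding [x] gives (q+1)q+1. *)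
Lemma card_side x : #|side x| = n.
Proof.
rewrite (cardsD1 x) side_refl.
have ->: side x :\ x = cover [set nbhd a :\ x | a in nbhd x].
  rewrite cover_imset; apply/setP=> w; rewrite in_setD1.
  apply/andP/bigcupP=> [[wx /sideP[a xa aw]]|[a]].
    by exists a; rewrite ?in_setD1 ?inE ?wx.
  by rewrite !inE => xa /andP[wx aw]; split=> //; apply/existsP; exists a; rewrite xa.
have cD a : a \in nbhd x -> #|nbhd a :\ x| = q.
  rewrite inE => xa; have := cardsD1 x (nbhd a).
  by rewrite [#|nbhd a|]moore_regular inE adj_sym xa; lia.
(* Disjoint blocks coming from different neighbours are different sets because none is empty, as q
   >= 1. *)
have [/eqP tI inj] : trivIset [set nbhd a :\ x | a in nbhd x]
     /\ {in nbhd x &, injective (fun a => nbhd a :\ x)}.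
  apply: trivIimset => [a b ax bx ab|]; last first.
    by apply/imsetP=> -[a /cD + e]; rewrite -e cards0; lia.
  rewrite -setI_eq0; apply/eqP/setP=> w; rewrite !inE in ax bx *.
  apply/negP=> /andP[/andP[wx bw] /andP[_ aw]].
  by case/eqP: ab; apply: (@common_nbr_uniq x w); rewrite // eq_sym.
rewrite -tI big_imset //= (eq_bigr (fun=> q)) //.
by rewrite sum_nat_const [#|nbhd x|]moore_regular /n; lia.
Qed.

(** An edge [u v] would close the 5-cycle x, a, u, v, b; if two of these vertices coincide, a
    triangle or a loop appears instead. *)
Lemma side_independent x : independent (side x).
Proof.
move=> u v /sideP[a xa au] /sideP[b xb bv]; apply/negP=> uv.
have [ab|ab] := eqVneq a b.
  by have := no_triangle au uv; rewrite adj_sym ab bv.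
have ux : u != x.
  apply: contraTneq uv => ->; rewrite adj_sym; exact: no_triangle xb bv.
have vx : v != x.
  apply: contraTneq uv => ->; exact: no_triangle xa au.
have ub : u != b.
  by apply: contraTneq au => ->; apply: no_triangle xa; rewrite adj_sym.
have av : a != v.
  by apply: contraTneq bv => <-; apply: no_triangle xb; rewrite adj_sym.
apply: (@moore_short_cycle [:: x; a; u; v; b]) => //=.
  by rewrite xa au uv (adj_sym v) bv adj_sym xb.
rewrite !inE !negb_or ab av ub (eq_sym x u) (eq_sym x v) ux vx.
rewrite (adj_neq xa) (adj_neq au) (adj_neq xb) (adj_neq uv).
by rewrite eq_sym adj_neq.
Qed.

(** * Independent sets of maximum size *)

Lemma card_compl I : #|I| = n -> #|~: I| = n.
Proof. by move=> cI; have := cardsC I; rewrite moore_card cI; lia. Qed.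

Lemma independent_le I : independent I -> #|I| <= n.
Proof.
have d_gt0: 0 < q + 1 by rewrite addn1.
move/(card_independent d_gt0 moore_regular); have := cardsC I.
by rewrite moore_card; lia.
Qed.

Lemma independentC I : independent I -> #|I| = n -> independent (~: I).
Proof.
move=> indI cI; apply: (half_independentC moore_regular) => //.
by rewrite card_compl.
Qed.

(** The complement is independent too, so two steps from [u] lead back into [I]; the cardinalities
    then agree. *)
Lemma max_independent_side I u :
  independent I -> #|I| = n -> u \in I -> side u = I.
Proof.
move=> indI cI uI; apply/eqP; rewrite eqEcard card_side cI leqnn andbT.
apply/subsetP=> w /sideP[a ua aw].
have aI : a \in ~: I.
  by rewrite inE; apply: contraTN ua => aI; apply: indI.
by rewrite -[I]setCK inE; apply: contraTN aw => wI; apply: (@independentC I).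
Qed.

Lemma same_side x u v : (u \in side x) = (v \in side x) -> v \in side u.
Proof.
move=> uv; have [ux|] := boolP (u \in side x).
  rewrite (@max_independent_side (side x)) ?card_side -?uv //.
  exact: side_independent.
rewrite -in_setC => ux; rewrite (@max_independent_side (~: side x)) //.
- by rewrite inE -uv -in_setC.
- by apply: independentC (card_side x); apply: side_independent.
- exact/card_compl/card_side.
Qed.

(** Diameter at most 3, so a color above 2 cannot repeat. If [v] is not in [side u], any neighbour
    of [v] is. *)
Lemma walk_le3 u v : exists2 m, walk_of_length u v m & m <= 3.
Proof.
have [/sideP[a ua av]|nuv] := boolP (v \in side u).
  by exists 2 => //; apply: walk2 av.
have [w vw] := has_nbr v.
have /sideP[a ua aw] : w \in side u.
  have indC := independentC (@side_independent u) (card_side u).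
  rewrite -[side u]setCK inE; apply: contraTN vw => wC.
  by apply: indC; rewrite // inE.
by exists 3 => //; apply: walk3 ua aw _; rewrite adj_sym.
Qed.

(** * Packing colorings: upper and lower bounds *)

Lemma moore_packing_colorable : packing_colorable G (n + 1).
Proof.
have /card_gt0P[x _] : 0 < #|G| by rewrite moore_card /n; lia.
set C := ~: side x.
have cC : #|C| = n := card_compl (card_side x).
(* Indices start at 0, so [C] receives the colors 2, ..., n+1, each once; only color 1 repeats. *)
pose f := [ffun u : G =>
  inord (if u \in C then (index u (enum C)).+2 else 1) : 'I_(n + 1).+1].
have idx u : u \in C -> index u (enum C) < n.
  by move=> uC; rewrite -cC cardE index_mem mem_enum.
have fE u : f u = (if u \in C then (index u (enum C)).+2 else 1) :> nat.
  by rewrite ffunE inordK //; case: ifP => [/idx|]; lia.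
apply/existsP; exists f; apply/andP; split.
  by apply/forallP=> u; rewrite fE; case: ifP.
apply/forallP=> u; apply/forallP=> v; apply/implyP=> /andP[uv].
rewrite -val_eqE /= !fE; case: ifP => uC; case: ifP => vC //.
  rewrite !eqSS => /eqP/(congr1 (nth u (enum C))).
  by rewrite !nth_index ?mem_enum // => e; rewrite e eqxx in uv.
move=> _; rewrite gdist_at_least2 uv; apply: (@side_independent x).
  by move: uC; rewrite inE => /negbFE.
by move: vC; rewrite inE => /negbFE.
Qed.

Lemma moore_packing_ge k : packing_colorable G k -> n + 1 <= k.
Proof.
case/existsP=> f /andP[/forallP f_gt0 /forallP pf].
have far u v m : u != v -> f u = f v -> walk_of_length u v m -> f u < m.
  move=> uv fuv; have /forallP/(_ v)/implyP := pf u.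
  by rewrite uv fuv eqxx => /(_ isT)/gdist_at_leastP; apply.
pose C i := [set u | f u == i :> nat].
have indC1 : independent (C 1).
  move=> u v; rewrite !inE => /eqP fu /eqP fv; apply/negP=> uv.
  suff: f u < 1 by rewrite fu.
  apply: (@far u v); first exact: adj_neq.
    by apply: val_inj; rewrite /= fu fv.
  by apply/existsP; exists [tuple v]; rewrite /= uv eqxx.
have C2_side u v : u \in C 2 -> v \in C 2 -> v \in side u -> u = v.
  rewrite !inE => /eqP fu /eqP fv /existsP[a /andP[ua av]].
  apply/eqP/negPn/negP=> uv.
  suff: f u < 2 by rewrite fu.
  apply: (far u v _) (walk2 ua av) => //.
  by apply: val_inj; rewrite /= fu fv.
have C2_half x (s : bool) : #|[set u in C 2 | (u \in side x) == s]| <= 1.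
  apply/card_le1_eqP=> u v /setIdP[uC /eqP us] /setIdP[vC /eqP vs].
  by apply: C2_side => //; apply: (@same_side x); rewrite us vs.
have le12 : #|C 1| + #|C 2| <= n + 1.
  have le1 := independent_le indC1.
  (* If color 1 misses the bound n, it is enough that color 2 occurs at most once in each part. *)
  have [eq1|ne1] := eqVneq #|C 1| n; last first.
    have /card_gt0P[x _] : 0 < #|G| by rewrite moore_card /n; lia.
    suff: #|C 2| <= 2 by lia.
    rewrite -[#|C 2|](cardsID (side x)).
    apply: (@leq_add _ _ 1 1); [have := C2_half x true|have := C2_half x false].
      by apply: leq_trans; apply/subset_leq_card/subsetP=> u; rewrite !inE eqb_id.
    by apply: leq_trans; apply/subset_leq_card/subsetP=> u; rewrite !inE eqbF_neg andbC.
  (* Here [C 1] is the whole part [side x], so [C 2] lies in the other part. *)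
  have /card_gt0P[x xC] : 0 < #|C 1| by rewrite eq1 /n; lia.
  rewrite eq1 leq_add2l; apply: leq_trans (C2_half x false).
  apply/subset_leq_card/subsetP=> u uC; rewrite inE uC.
  rewrite (@max_independent_side (C 1)) // inE.
  by move: uC; rewrite inE => /eqP->.
have leR : #|~: (C 1 :|: C 2)| <= k - 2.
  have inj : {in ~: (C 1 :|: C 2) &, injective f}.
    move=> u v; rewrite !inE => /norP[/eqP fu1 /eqP fu2] _ fuv; apply/eqP/negPn/negP=> uv.
    have [m w m3] := walk_le3 u v.
    have := far _ _ _ uv fuv w; have := f_gt0 u.
    move: (nat_of_ord (f u)) fu1 fu2; lia.
  rewrite -(card_in_imset inj).
  (* The shift by 3 enumerates the remaining colors 3, ..., k. *)
  have sub : f @: (~: (C 1 :|: C 2)) \subset [set inord (i + 3) | i : 'I_(k - 2)].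
    apply/subsetP=> _ /imsetP[u + ->]; rewrite !inE => /norP[/eqP fu1 /eqP fu2].
    have fu0 := f_gt0 u; have fuk := ltn_ord (f u).
    have [ge3 lt] : 3 <= f u /\ f u - 3 < k - 2.
      by move: (nat_of_ord (f u)) fu0 fuk fu1 fu2; lia.
    apply/imsetP; exists (Ordinal lt) => //; apply: val_inj.
    by rewrite /= subnK // inordK.
  apply: leq_trans (subset_leq_card sub) _.
  by rewrite -[leqRHS]card_ord; apply: leq_imset_card.
(* In total 2n <= (n+1) + (k-2). Since n >= 3, the truncated difference k-2 is positive, and k >=
   n+1 follows. *)
have := cardsC (C 1 :|: C 2); have := cardsU (C 1) (C 2).
rewrite moore_card /n; move: le12 leR; rewrite /n; lia.
Qed.

End Moore.

Unset Implicit Arguments.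

Theorem theorem3p1 (q : nat) (hq : 1 <= q) (G : sgraph)
  (hG : moore_graph G (q + 1) 6) :
  packing_chromatic_number G = q ^ 2 + q + 2.
Proof.
rewrite /packing_chromatic_number; case: ex_minnP => k kP kmin.
(* The literal 2 is read as 1 + 1, which exposes n+1 for n = q^2+q+1. *)
apply/eqP; rewrite eqn_leq (addnA _ 1 1).
by rewrite kmin ?(moore_packing_ge hq hG) //; apply: moore_packing_colorable hG.
Qed.
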